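(* Let $X=\{X_t\}_{t\ge0}$ be a finite reversible Markov chain with $n$ states such that all eigenvalues of its transition matrix are non-negative, and let $x$ and $y$ be any two states. Then, for all integers $t>n$, $$\mathbf{P}_x(\tau(y)=t)\le\frac12\sqrt{\frac{n}{t(t-n)}}.$$
   Context: Markov chains are in discrete time and time-homogeneous, with state space $S$ and transition probabilities $p(\cdot,\cdot)$. Reversible means that there is a probability distribution $\pi$ on $S$ with $\pi(a)>0$ for all $a\in S$ and $\pi(a)p(a,b)=\pi(b)p(b,a)$ for all $a,b\in S$. $\mathbf{P}_x$ denotes the probability for the chain started at $X_0=x$. The hitting time is $\tau(y)=\min\{t\ge 0: X_t=y\}$ ($\infty$ if $y$ is never reached). *)

(* Defs.v *)
From HB Require Import structures.
From mathcomp Require Import all_boot all_order all_algebra.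
From mathcomp Require Import all_classical all_reals all_analysis.

Set Implicit Arguments.
Unset Strict Implicit.
Unset Printing Implicit Defensive.

Import Order.TTheory GRing.Theory Num.Theory.

Local Open Scope classical_set_scope.
Local Open Scope ring_scope.

Definition stochastic (R : realType) (S : finType) (p : S -> S -> R) : Prop :=
  (forall a b, 0 <= p a b) /\ (forall a, \sum_(b : S) p a b = 1).

Definition reversible (R : realType) (S : finType) (p : S -> S -> R) : Prop :=
  exists pi : S -> R,
    [/\ forall a, 0 < pi a,
        \sum_(a : S) pi a = 1 &
        forall a b, pi a * p a b = pi b * p b a].

Definition transition_matrix (R : realType) (S : finType) (p : S -> S -> R) :
    'M[R]_#|S| :=
  \matrix_(i < #|S|, j < #|S|) p (enum_val i) (enum_val j).

Definition path_event (T : Type) (S : finType) (X : nat -> T -> S)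
    (s : nat -> S) (t : nat) : set T :=
  [set w | forall i, (i <= t)%N -> X i w = s i].

(* S carries the discrete sigma-algebra, so a map to S is measurable exactly
   when the preimages of points are.  The Markov property
     P(X_(t+1) = s_(t+1) | X_0 = s_0, ..., X_t = s_t) = p(s_t, s_(t+1))
   is written multiplicatively, so that nothing is required when the
   conditioning event is negligible. *)
Definition markov_chain (R : realType) (d : measure_display)
    (T : measurableType d) (P : probability T R) (S : finType)
    (p : S -> S -> R) (X : nat -> T -> S) : Prop :=
  (forall t a, measurable (X t @^-1` [set a])) /\
  (forall (s : nat -> S) (t : nat),
     P (path_event X s t.+1) =
       (P (path_event X s t) * (p (s t) (s t.+1))%:E)%E).

(* None stands for infinity. *)
Definition hitting_time (T : Type) (S : finType) (X : nat -> T -> S) (y : S)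
    (w : T) : option nat :=
  match pselect (exists t, X t w == y) with
  | left hit => Some (ex_minn hit)
  | right _ => None
  end.

(* Main.v *)
Require Import Defs.
From HB Require Import structures.
From mathcomp Require Import complex.
From mathcomp Require Import all_boot all_order all_algebra.
From mathcomp Require Import all_classical all_reals all_analysis.
From mathcomp Require Import ring lra zify.

(** The chain killed on hitting [y] is conjugate to a nonnegative symmetric matrix that
    is positive semidefinite, and so is each of its restrictions to a smaller set of
    states. By the spectral theorem its return probabilities to a state are mixtures of
    geometric sequences. Cutting a trajectory from [x] to [y] at the last visit to [x], then
    at the last visit to the next state, and so on, exhibits the law of the hitting time
    as a mixture of laws of sums of [k < n] independent geometric variables.

    It remains to bound [h_(t-k)(a_1, ..., a_k) (1 - a_1) ... (1 - a_k)], the probability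
    that such a sum equals [t], where [h] is the complete homogeneous symmetric polynomial.
    On [[0, 1]^k] this has a maximum. At a maximum the derivative conditions together with
    log-concavity force all the parameters to be equal, and then to be [(t - k) / t]. The
    value there is a binomial probability times [k / t], which Stirling's bound controls.

    Eigenvalues 1 are avoided by giving each step the weight [th < 1] and letting [th]
    tend to 1. *)

Set Implicit Arguments.
Unset Strict Implicit.
Unset Printing Implicit Defensive.

Import Order.TTheory GRing.Theory Num.Theory.
Import numFieldNormedType.Exports.

Local Open Scope ring_scope.

(** * Convolutions of geometric sequences *)

Section GeometricConvolution.
Context {R : realFieldType}.
Implicit Types (a c : R) (l r : seq R) (t : nat) (f : nat -> R).

(* Coefficients of z f(z) / (1 - a z). *)
Fixpoint geom_conv a f t : R :=
  if t is t'.+1 then a * geom_conv a f t' + f t' else 0.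

(* At [t] this is the complete homogeneous symmetric polynomial of degree
   [t - size l] in [l], and 0 if [t < size l]. *)
Definition geo l : nat -> R := foldr geom_conv (fun t => (t == 0)%:R) l.

Lemma geo_cons0 a l : geo (a :: l) 0 = 0. Proof. by []. Qed.

Lemma geo_consS a l t : geo (a :: l) t.+1 = a * geo (a :: l) t + geo l t.
Proof. by []. Qed.

Lemma eq_geom_conv a f g : f =1 g -> geom_conv a f =1 geom_conv a g.
Proof. by move=> fg; elim=> //= t ->; rewrite fg. Qed.

(** Both sides have generating function z^2 f(z) / ((1 - a z)(1 - c z)). The recurrence behind it
    has order two, so the induction carries two consecutive values. *)
Lemma geom_convC a c f : geom_conv a (geom_conv c f) =1 geom_conv c (geom_conv a f).
Proof.
move=> t; suff: geom_conv a (geom_conv c f) t = geom_conv c (geom_conv a f) t /\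
    geom_conv a (geom_conv c f) t.+1 = geom_conv c (geom_conv a f) t.+1 by case.
elim: t => [|t [IH1 IH2]]; first by rewrite /= !mulr0 !addr0.
split=> //.
move: IH1 IH2; rewrite /=; set X := geom_conv a _ t; set Y := geom_conv c _ t => -> E.
have {E} /(congr1 ( *%R (a + c))) : a * Y + geom_conv c f t = c * Y + geom_conv a f t.
  by [].
lra.
Qed.

Lemma geo_perm l r : perm_eq l r -> geo l =1 geo r.
Proof.
elim: l r => [|a l IH] r.
  by move=> /perm_size/esym/size0nil ->.
move=> lr; have ar : a \in r by rewrite -(perm_mem lr) mem_head.
have {lr} /IH lr : perm_eq l (rem a r).
  by rewrite -(perm_cons a) (perm_trans lr) // perm_to_rem.
suff H r' : a \in r' -> geo r' =1 geo (a :: rem a r').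
  by move=> t; rewrite (H r) //; exact: (eq_geom_conv a lr).
elim: r' => //= b r' IHr; rewrite inE; case: eqVneq => [-> //|nab] /= ar' t.
rewrite geom_convC.
exact: (eq_geom_conv b (IHr ar')).
Qed.

(** Partial fractions: 1/(1 - a z) - 1/(1 - c z) = (a - c) z / ((1 - a z)(1 - c z)). Difference
    quotients in a parameter thus become [geo] of a longer list. *)
Lemma geo_sub a c l t :
  geo (a :: l) t - geo (c :: l) t = (a - c) * geo (a :: c :: l) t.
Proof.
elim: t => [|t IH]; first by rewrite !geo_cons0 mulr0 subrr.
rewrite !geo_consS mulrDr mulrCA -IH; ring.
Qed.

Lemma geo_small l t : (t < size l)%N -> geo l t = 0.
Proof.
elim: l t => // a l IH; elim=> [//|t IHt] lt.
by rewrite geo_consS IHt ?IH ?mulr0 ?addr0 // ltnW.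
Qed.

Lemma geo_ge0 l t : all (>= 0) l -> 0 <= geo l t.
Proof.
elim: l t => [|a l IH] t /=; first by rewrite ler0n.
case/andP=> a0 l0; elim: t => // t IHt.
by rewrite addr_ge0 ?mulr_ge0 ?IH.
Qed.

(** The negative binomial series: a coefficient of (z / (1 - c z))^(k+1). *)
Lemma geo_nseq k c t : geo (nseq k.+1 c) t.+1 = 'C(t, k)%:R * c ^+ (t - k).
Proof.
elim: k t => [|k IHk]; elim=> [|t IHt].
- by rewrite /= !mulr0 add0r bin0 mulr1.
- rewrite geo_consS IHt !bin0 !mul1r /= addr0 !subn0 exprS //.
- by rewrite geo_consS geo_cons0 (@geo_small _ 0) // mulr0 add0r bin_small ?mul0r.
rewrite geo_consS IHt -/(nseq k.+1 c) IHk binS natrD.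
have [tk|kt|->] := ltngtP t k.
- by rewrite !bin_small ?leqW // addr0 !mul0r mulr0 addr0.
- rewrite mulrDl; congr (_ + _); rewrite mulrCA -exprS; rewrite -subSn //.
- by rewrite bin_small // subSS subnn mul0r mulr0 !add0r.
Qed.

(* Log-concavity, stated for all shifts so that no division by [f] is ever needed. *)
Definition log_concave f := forall i j m, (i <= j)%N ->
  f i * f (j + m)%N <= f (i + m)%N * f j.

Lemma geom_conv_log_concave a f : 0 <= a -> (forall t, 0 <= f t) ->
  log_concave f -> log_concave (geom_conv a f).
Proof.
move=> a0 f0 lf.
have g0 t : 0 <= geom_conv a f t.
  by elim: t => //= t IH; rewrite addr_ge0 ?mulr_ge0.
(* In product form and with a shift: the ratio of the convolution to [f] is nondecreasing. *)
have K i j m : (i <= j)%N ->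
    geom_conv a f i * f (j + m)%N <= f (i + m)%N * geom_conv a f j.
  elim: i j m => [|i IH] [|j] m //= ij; rewrite ?mul0r ?mulr0 ?mulr_ge0 ?addr_ge0 ?mulr_ge0 //.
  rewrite mulrDl mulrDr lerD // ?addSnnS; last exact: lf.
  by rewrite -mulrA [leRHS]mulrCA ler_wpM2l // IH.
move=> i j m ij; elim: m => [|m IH]; first by rewrite !addn0.
rewrite !addnS /= mulrDr mulrDl lerD //; last exact: K.
by rewrite mulrCA -mulrA ler_wpM2l.
Qed.

Lemma geo_log_concave l : all (>= 0) l -> log_concave (geo l).
Proof.
elim: l => [_|a l IH] /=.
  by case=> [|i] [|j] [|m] //= _; rewrite ?mulr0 ?mul0r ?mulr_ge0 ?ler0n.
case/andP=> a0 l0; apply: geom_conv_log_concave => //; last exact: IH.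
by move=> t; exact: geo_ge0.
Qed.

(** Successive ratios of a log-concave sequence are nonincreasing, so one step up forces every
    earlier step to be up. *)
Lemma log_concave_unimodal f i t : log_concave f -> (forall u, 0 <= f u) ->
  0 < f t.+1 -> f t <= f t.+1 -> (i <= t.+1)%N -> f i <= f t.+1.
Proof.
move=> lf f0 ft0 ft it.
suff mono u : (u < t.+1)%N -> f u <= f u.+1.
  elim: t.+1 it mono {lf f0 ft0 ft} => [|m IH]; first by rewrite leqn0 => /eqP ->.
  rewrite leq_eqVlt => /predU1P[-> //|im] mono.
  by apply: le_trans (mono m (ltnSn m)); apply: IH => // u um; apply: mono; rewrite leqW.
rewrite ltnS => ut; have := lf u t 1%N ut; rewrite !addn1 => H.
by rewrite -(ler_pM2r ft0); apply: le_trans H _; rewrite ler_wpM2l.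
Qed.

(* The convolution with a nondegenerate geometric law averages [f] over the past
   together with a positive fraction of zeros. *)
Lemma geom_conv_lt a f t : 0 < a < 1 -> 0 < f t ->
  (forall i, (i < t)%N -> f i <= f t) -> (1 - a) * geom_conv a f t < f t.
Proof.
case/andP=> a0 a1 ft0 fle.
(* The weights [(1 - a) * a ^+ s] with [s < t] add up to [1 - a ^+ t]; the missing mass gives
   strictness. *)
suff : (1 - a) * geom_conv a f t <= (1 - a ^+ t) * f t.
  move/le_lt_trans; apply; rewrite gtr_pMl // ltrBlDr ltrDl exprn_gt0 //.
have : forall u, (u <= t)%N -> (1 - a) * geom_conv a f u <= (1 - a ^+ u) * f t.
  elim=> [|u IH] ut /=; first by rewrite expr0 subrr mulr0 mul0r.
  have /(ler_wpM2l (ltW a0)) {}IH := IH (ltnW ut).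
  have {}fle := fle u ut.
  have : (1 - a) * f u <= (1 - a) * f t by rewrite ler_wpM2l // subr_ge0 ltW.
  rewrite exprS; lra.
exact.
Qed.

End GeometricConvolution.

(** * Spectral moments of a symmetric matrix *)

Section SymmetricMoments.
Context {R : rcfType}.
Local Notation toC := (real_complex R).
Local Open Scope sesquilinear_scope.

(** The spectral theorem over the complex numbers, brought back to [R]: the weights are the squared
    moduli of the coordinates of [v] in an orthonormal eigenbasis, and the eigenvalues are real. *)
Lemma symmetric_moments n (A : 'M[R]_n) (v : 'rV_n) : A^T = A ->
  exists w d : 'I_n -> R, [/\ forall k, 0 <= w k, forall k, eigenvalue A (d k) &
    forall s, (iter s (mulmx^~ A) v *m v^T) 0 0 = \sum_k w k * d k ^+ s].
Proof.
move=> symA; pose B := map_mx toC A; pose vC := map_mx toC v.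
have conjR m (M : 'M[R]_(1, m)) : (map_mx toC M)^t* = (map_mx toC M)^T.
  by apply/matrixP => i j; rewrite !mxE; apply/CrealP/complex_realP; exists (M j i).
have Bherm : B \is hermsymmx.
  apply: realsym_hermsym.
    by apply/is_hermitianmxP; rewrite expr0 scale1r map_mx_id // map_trmx symA.
  by apply/mxOverP => i j; rewrite mxE; apply/complex_realP; exists (A i j).
have /orthomx_spectralP BE := hermitian_normalmx Bherm.
have Dreal := hermitian_spectral_diag_real Bherm.
have Punit := spectral_unitarymx B.
have Pinv := spectral_unit B.
move: BE Dreal Punit Pinv; set P := spectralmx B; set D := spectral_diag B.
move=> BE Dreal Punit Pinv.
have DE k : D 0 k = toC (complex.Re (D 0 k)) by rewrite RRe_real // (mxOverP Dreal).
pose u := vC *m invmx P.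
have uT : P *m vC^T = u^t*.
  by rewrite /u invmx_unitary // trmx_mul map_mxM conjR trmxCK.
have iterC s : map_mx toC (iter s (mulmx^~ A) v) =
    (\row_k (u 0 k * D 0 k ^+ s)) *m P.
  elim: s => [|s IH] /=.
    have -> : \row_k (u 0 k * D 0 k ^+ 0) = u.
      by apply/rowP => k; rewrite mxE mulr1.
    by rewrite mulmxKV.
  rewrite map_mxM /= IH -/B BE !mulmxA mulmxK //; congr (_ *m _).
  by apply/rowP => k; rewrite mul_mx_diag !mxE exprSr mulrA.
clearbody u.
exists (fun k => complex.Re (`|u 0 k| ^+ 2)), (fun k => complex.Re (D 0 k)); split.
- by move=> k; rewrite -lecR RRe_real ?exprn_ge0 // ger0_real ?exprn_ge0.
- move=> k; have := eigenvalue_map (real_complex R) A (complex.Re (D 0 k)).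
  rewrite -/B /= -(DE k) => <-; apply/eigenvalueP.
  exists (row k P); last first.
    apply: contraTneq Pinv => rP; rewrite -row_free_unit -kermx_eq0.
    apply/negP => /eqP kP.
    have : delta_mx 0 k *m P = 0 :> 'rV_n by rewrite -rowE.
    move/sub_kermxP; rewrite kP submx0 => /eqP/matrixP/(_ 0 k).
    by rewrite !mxE !eqxx => /eqP; rewrite oner_eq0.
  rewrite {1}BE !mulmxA rowE mulmxK // scalemxAl; congr (_ *m _).
  apply/rowP => j; rewrite mul_mx_diag !mxE eqxx /=.
  by case: eqP => [->|]; rewrite ?mulr1 ?mul1r // mulr0 mul0r.
move=> s; apply: (complexI (R := R)).
have -> : toC ((iter s (mulmx^~ A) v *m v^T) 0 0) =
    (map_mx toC (iter s (mulmx^~ A) v) *m vC^T) 0 0.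
  by rewrite /vC map_trmx -map_mxM [RHS]mxE.
rewrite iterC -mulmxA uT mxE rmorph_sum; apply: eq_bigr => k _.
transitivity (`|u 0 k| ^+ 2 * D 0 k ^+ s); first by rewrite !mxE normCK; ring.
rewrite [in RHS]rmorphM [in RHS]rmorphXn; congr (_ * _ ^+ _); last exact: DE.
by apply/esym/RRe_real; rewrite ger0_real // exprn_ge0.
Qed.

End SymmetricMoments.

(** * Stirling's bound *)

Local Open Scope classical_set_scope.
Local Open Scope ring_scope.

Section Stirling.
Context {R : realType}.
Implicit Types (u : R) (k n s t : nat).

Lemma ge0_is_derive_ge1 (f f' : R -> R) u :
  (forall v : R, 1 <= v -> is_derive v 1 f (f' v)) ->
  (forall v : R, 1 <= v -> 0 <= f' v) -> 1 <= u -> f 1 <= f u.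
Proof.
move=> df f'0 u1; apply: (@ger0_derive1_ndecry _ _ 1) => // [x|x|].
- by rewrite in_itv /= andbT => /ltW /df[].
- rewrite in_itv /= andbT => /ltW x1.
  by rewrite derive1E (@derive_val _ _ _ _ _ _ _ (df x x1)) f'0.
apply: derivable_within_continuous => x.
by rewrite in_itv /= andbT => /df[].
Qed.

(** The left side is 2 (u - 1) / (u + 1), which at u = (n + 1) / n equals 1 / (n + 1/2): exactly
    what makes [stirling_ln] decrease. *)
Lemma ln_lower_bound u : 1 <= u -> 2 - 4 / (u + 1) <= ln u.
Proof.
move=> u1.
pose f' v : R := v^-1 - 4 / (v + 1) ^+ 2.
have df (v : R) : 1 <= v -> is_derive v 1 (fun w : R => ln w + 4 * (w + 1)^-1) (f' v).
  move=> v1; have v0 : 0 < v by lra.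
  have v10 : v + 1 != 0 by rewrite gt_eqF //; lra.
  have h1 : is_derive v 1 (fun w : R => w + 1) 1.
    by apply: is_derive_eq; rewrite addr0.
  have h2 := is_deriveV (f := fun w : R => w + 1) v10 h1.
  have h3 := is_derive1_ln v0.
  have h4 := is_deriveD h3 (is_deriveZ 4 h2).
  apply: (is_derive_eq h4); rewrite /f' /GRing.scale /=.
  by rewrite mulr1 mulrN.
have f'0 (v : R) : 1 <= v -> 0 <= f' v.
  move=> v1; rewrite /f'.
  have -> : v^-1 - 4 / (v + 1) ^+ 2 = (v - 1) ^+ 2 / (v * (v + 1) ^+ 2).
    by field; apply/andP; split; rewrite gt_eqF //; lra.
  by rewrite divr_ge0 ?sqr_ge0 // mulr_ge0 ?sqr_ge0 //; lra.
have := ge0_is_derive_ge1 df f'0 u1; rewrite /= ln1 -[1 + 1]/(2%:R); lra.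
Qed.

(** At u = (m + 1) / m the right side times m + 1/2 exceeds 1 by 1/(4m) - 1/(4(m + 1)), a
    telescoping error. *)
Lemma ln_upper_bound u : 1 <= u -> ln u <= (u - u^-1) / 2.
Proof.
move=> u1.
pose f' v : R := 2^-1 * (1 - v^-1) ^+ 2.
have df (v : R) : 1 <= v -> is_derive v 1 (fun w : R => 2^-1 * (w - w^-1) - ln w) (f' v).
  move=> v1; have v0 : 0 < v by lra.
  have v10 : v != 0 by rewrite gt_eqF //; lra.
  have h1 := is_deriveV (f:=id) v10 (is_derive_id v 1).
  have h2 := is_derive1_ln v0.
  have h3 := is_deriveB (is_deriveZ 2^-1 (is_deriveB (is_derive_id v 1) h1)) h2.
  apply: (is_derive_eq h3); rewrite /f' /GRing.scale /=.
  by field.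
have f'0 (v : R) : 1 <= v -> 0 <= f' v.
  by move=> v1; rewrite /f' mulr_ge0 ?sqr_ge0.
have := ge0_is_derive_ge1 df f'0 u1; rewrite ln1 invr1; lra.
Qed.


(* log (n! e^n n^(- n - 1/2)), which decreases to log (2 pi) / 2. *)
Definition stirling_ln n : R := ln n`!%:R + n%:R - (n%:R + 2^-1) * ln n%:R.

Lemma stirling_ln_step n : (0 < n)%N ->
  stirling_ln n - stirling_ln n.+1 = (n%:R + 2^-1) * ln (n.+1%:R / n%:R) - 1.
Proof.
move=> n0; rewrite /stirling_ln factS natrM lnM ?posrE ?ltr0n ?fact_gt0 //.
by rewrite ln_div ?posrE ?ltr0n // -natr1; ring.
Qed.

Lemma stirling_ln_succ_le n : (0 < n)%N -> stirling_ln n.+1 <= stirling_ln n.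
Proof.
move=> n0; rewrite -subr_ge0 stirling_ln_step //.
have x0 : 0 < n%:R :> R by rewrite ltr0n.
have /ln_lower_bound H : 1 <= n.+1%:R / n%:R :> R.
  by rewrite ler_pdivlMr // mul1r ler_nat.
have c0 : 0 <= n%:R + 2^-1 :> R by lra.
have := ler_wpM2l c0 H; rewrite subr_ge0; apply: le_trans.
rewrite -natr1 le_eqVlt; apply/orP; left.
by apply/eqP; field; rewrite ?gt_eqF //; lra.
Qed.

Lemma stirling_ln_le n t : (0 < n)%N -> (n <= t)%N -> stirling_ln t <= stirling_ln n.
Proof.
move=> n0; elim: t => [|t IH]; first by rewrite leqn0 => /eqP ->.
rewrite leq_eqVlt => /predU1P[-> //|nt].
by apply: le_trans (IH nt); apply: stirling_ln_succ_le; exact: leq_trans n0 nt.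
Qed.

(** The difference [stirling_ln n] - 1/(4n) is nondecreasing, and its value at 1 is 3/4. *)
Lemma stirling_ln_ge n : (0 < n)%N -> 3 / 4 + (4 * n%:R)^-1 <= stirling_ln n.
Proof.
case: n => // n _; elim: n => [|n IH].
  by rewrite /stirling_ln (_ : 1`! = 1)%N // ln1; lra.
set m := n.+1 in IH *; have m0 : (0 < m)%N by [].
have x0 : 0 < m%:R :> R by rewrite ltr0n.
have /ln_upper_bound H : 1 <= m.+1%:R / m%:R :> R.
  by rewrite ler_pdivlMr // mul1r ler_nat.
have c0 : 0 <= m%:R + 2^-1 :> R by lra.
have {}H := ler_wpM2l c0 H.
have := stirling_ln_step m0.
move: H IH; rewrite -[m.+1%:R]natr1; set L := ln _; set x : R := m%:R => H IH E.
have {}H : (x + 2^-1) * L - 1 <= (4 * x)^-1 - (4 * (x + 1))^-1.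
  rewrite lerBlDr (le_trans H) // le_eqVlt; apply/orP; left; apply/eqP.
  by field; rewrite -/x ?gt_eqF //; lra.
lra.
Qed.

(** The same 3/4 as in [stirling_ln_ge]; this is how the factor 1/2 of the final bound arises. *)
Lemma ln2_le : ln 2 <= 3 / 4 :> R.
Proof.
have : 1 <= 2 :> R by lra.
by move=> /ln_upper_bound; lra.
Qed.

(** With t = k + s, the logarithm of the left side is that of the square root plus [stirling_ln t -
    stirling_ln k - stirling_ln s]. Here [stirling_ln t <= stirling_ln s], and [stirling_ln k] is at
    least 3/4, hence at least ln 2. *)
Lemma binomial_mode_le k s : (0 < k)%N -> (0 < s)%N ->
  'C((k + s).-1, k.-1)%:R * (k%:R / (k + s)%:R) ^+ k * (s%:R / (k + s)%:R) ^+ s <=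
  2^-1 * Num.sqrt (k%:R / ((k + s)%:R * s%:R)) :> R.
Proof.
move=> k0 s0; set t := (k + s)%N.
have t0 : (0 < t)%N by rewrite addn_gt0 k0.
have [x0 y0 z0] : [/\ 0 < k%:R :> R, 0 < s%:R :> R & 0 < t%:R :> R].
  by rewrite !ltr0n.
have C0 : (0 < 'C(t.-1, k.-1))%N by rewrite bin_gt0 /t; lia.
have Cf : ('C(t.-1, k.-1) * (k`! * s`!) * t = k * t`!)%N.
  have kt : (k.-1 <= t.-1)%N by rewrite /t; lia.
  have -> : s`! = (t.-1 - k.-1)`! by congr _`!; rewrite /t; lia.
  rewrite -[in LHS](prednK k0) factS (prednK k0) -(prednK t0) factS (prednK t0).
  rewrite -(bin_fact kt); ring.
have /(congr1 (fun m : nat => ln (m%:R : R))) := Cf.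
rewrite !natrM !lnM ?posrE ?mulr_gt0 ?ltr0n ?fact_gt0 // => Cln.
pose w : R := Num.sqrt (k%:R / (t%:R * s%:R)).
have q0 : 0 < k%:R / (t%:R * s%:R) :> R by rewrite divr_gt0 ?mulr_gt0.
have w0 : 0 < w by rewrite sqrtr_gt0.
have wln : ln w *+ 2 = ln k%:R - (ln t%:R + ln s%:R).
  by rewrite -lnXn // sqr_sqrtr ?ltW // ln_div ?lnM ?posrE ?mulr_gt0.
rewrite -ler_ln ?posrE ?mulr_gt0 ?exprn_gt0 ?divr_gt0 ?invr_gt0 ?ltr0n //.
rewrite !lnM ?posrE ?mulr_gt0 ?exprn_gt0 ?divr_gt0 ?invr_gt0 ?ltr0n //.
rewrite !lnXn ?divr_gt0 // !ln_div ?posrE // lnV ?posrE // -/w.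
have kt : (s <= t)%N by rewrite /t; lia.
have := stirling_ln_le s0 kt; have := stirling_ln_ge k0; have := ln2_le.
have : 0 < (4 * k%:R)^-1 :> R by rewrite invr_gt0 mulr_gt0.
have tE : t%:R = k%:R + s%:R :> R by rewrite natrD.
rewrite /stirling_ln -(mulr_natr (_ - _) k) -(mulr_natr (_ - _) s).
move: Cln wln tE; rewrite mulr2n.
set c := ln 'C(_, _)%:R; set fk := ln k`!%:R; set fs := ln s`!%:R; set ft := ln t`!%:R.
set lk := ln k%:R; set ls := ln s%:R; set lt := ln t%:R; set lw := ln w.
move: (k%:R : R) (s%:R : R) (t%:R : R) => x y z Cln wln -> i0 l2 Sk Sts.
lra.
Qed.

End Stirling.

(** * The extremal sum of geometric variables *)

Section GeometricSums.
Context {R : realType}.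
Implicit Types (a c : R) (l r : seq R) (k t : nat).

(** A list of functions covers both uses: all coordinates of a cube at once, and a single varying
    parameter among constants. *)
Lemma continuous_geo (U : topologicalType) (fs : seq (U -> R)) t :
  {in fs, forall f, continuous f} ->
  continuous (fun v => geo [seq f v | f <- fs] t).
Proof.
elim: fs t => [|f fs IH] t fsc; first by move=> v; exact: cvg_cst.
have fc : continuous f by apply: fsc; rewrite mem_head.
have {}IH u : continuous (fun v => geo [seq g v | g <- fs] u).
  by apply: IH => g gs; apply: fsc; rewrite inE gs orbT.
elim: t => [|t IHt] v; first exact: cvg_cst.
by apply: cvgD; [apply: cvgM; [exact: fc|exact: IHt]|exact: IH].
Qed.

Definition geo_norm l : R := \prod_(a <- l) (1 - a).

Definition unit_seq k : set (seq R) :=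
  [set l | size l = k /\ all (fun a => 0 <= a <= 1) l].

Lemma continuous_geo_norm (U : topologicalType) (fs : seq (U -> R)) :
  {in fs, forall f, continuous f} -> continuous (fun v => geo_norm [seq f v | f <- fs]).
Proof.
elim: fs => [|f fs IH] fsc v.
  by rewrite /geo_norm; under eq_fun do rewrite big_nil; exact: cvg_cst.
rewrite /geo_norm; under eq_fun do rewrite /= big_cons; apply: cvgM.
  by apply: cvgB; [exact: cvg_cst|apply: fsc; rewrite mem_head].
by apply: IH => g gs; apply: fsc; rewrite inE gs orbT.
Qed.

Lemma continuous_norm_geo (U : topologicalType) (fs : seq (U -> R)) t :
  {in fs, forall f, continuous f} ->
  continuous (fun v => geo_norm [seq f v | f <- fs] * geo [seq f v | f <- fs] t).
Proof.
move=> fsc v; apply: cvgM; first exact: continuous_geo_norm.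
exact: continuous_geo.
Qed.

Lemma geo_maximizer k t : exists2 l, unit_seq k l &
  forall l', unit_seq k l' -> geo_norm l' * geo l' t <= geo_norm l * geo l t.
Proof.
pose fs := [seq (fun v : 'rV[R]_k => v ord0 i) | i <- enum 'I_k].
pose l_ (v : 'rV[R]_k) := [seq f v | f <- fs].
pose A : set 'rV[R]_k := [set v | forall i, `[0, 1]%classic (v ord0 i)].
have l_E v : l_ v = [seq v ord0 i | i <- enum 'I_k] by rewrite /l_ /fs -map_comp.
have Al v : A v -> unit_seq k (l_ v).
  move=> Av; split; first by rewrite l_E size_map size_enum_ord.
  by rewrite l_E; apply/allP => _ /mapP[i _ ->]; have := Av i; rewrite /= in_itv.
have fsc : {in fs, forall f, continuous f}.
  by move=> _ /mapP[i _ ->]; exact: coord_continuous.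
have cA : compact A.
  exact: (@rV_compact R k (fun=> `[0, 1]%classic) (fun i => @segment_compact R 0 1)).
have A0 : A !=set0.
  by exists 0 => i /=; rewrite in_itv /= mxE lexx ler01.
have cF : {within A, continuous (fun v => geo_norm (l_ v) * geo (l_ v) t)}.
  by apply: continuous_subspaceT; exact: continuous_norm_geo.
have [v] := EVT_max_rV A0 cA cF; rewrite inE => Av vmax.
exists (l_ v); first exact: Al.
move=> l [lk l01]; pose u : 'rV[R]_k := \row_i l`_i.
have ul : l_ u = l.
  apply: (@eq_from_nth _ 0) => [|i]; rewrite l_E size_map size_enum_ord // => ik.
  by rewrite (nth_map (Ordinal ik)) ?size_enum_ord // mxE nth_enum_ord.
rewrite -ul; apply: vmax; rewrite inE => i /=.
by rewrite mxE in_itv /= (allP l01) // mem_nth // lk.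
Qed.

Lemma geo_perm_norm l r t : perm_eq l r -> geo_norm l * geo l t = geo_norm r * geo r t.
Proof. by move=> lr; rewrite (geo_perm lr) /geo_norm (perm_big _ lr). Qed.

(** * First-order conditions in one parameter *)

Section Critical.
Context (c : R) (r : seq R) (t : nat).
Hypothesis cmax : forall a, 0 <= a <= 1 ->
  (1 - a) * geo (a :: r) t <= (1 - c) * geo (c :: r) t.

(** By [geo_sub] this is the difference quotient of [(1 - a) * geo (a :: r) t] between [a] and [c];
    its value at [c] is the derivative. *)
Let D a := (1 - a) * geo (a :: c :: r) t - geo (c :: r) t.

Let D_continuous : continuous D.
Proof.
move=> a; apply: cvgB; last exact: cvg_cst.
apply: cvgM; first by apply: cvgB; [exact: cvg_cst|exact: cvg_id].
pose fs : seq (R -> R) := id :: map (fun b => cst b) (c :: r).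
have E v : [seq f v | f <- fs] = v :: c :: r.
  by rewrite /fs /= -map_comp (eq_map (g := id)) ?map_id.
have : continuous (fun v => geo [seq f v | f <- fs] t).
  apply: continuous_geo => f; rewrite inE => /predU1P[->|/mapP[b _ ->]] v.
    exact: cvg_id.
  exact: cvg_cst.
by under eq_fun do rewrite E; exact.
Qed.

Let D_sign a : 0 <= a <= 1 -> (a - c) * D a <= 0.
Proof.
move=> /cmax; rewrite -subr_le0; congr (_ <= 0).
have := geo_sub a c r t; rewrite /D => /(congr1 ( *%R (1 - a))); lra.
Qed.

(** The quotient is taken from the right only, so that the endpoint [c = 0] is included. *)
Lemma geo_critical_le : 0 <= c < 1 -> (1 - c) * geo (c :: c :: r) t <= geo (c :: r) t.
Proof.
case/andP=> c0 c1; rewrite -subr_le0 -/(D c).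
apply: (cvgr_to_le (cvg_at_right_filter (@D_continuous c))).
near=> a; have ca : c < a by near: a; exact: nbhs_right_gt.
have a1 : a < 1 by near: a; exact: nbhs_right_lt.
rewrite -(pmulr_rle0 _ (_ : 0 < a - c)) ?subr_gt0 //; apply: D_sign.
by rewrite (le_trans c0 (ltW ca)) ltW.
Unshelve. all: by end_near. Qed.

Lemma geo_critical : 0 < c < 1 -> (1 - c) * geo (c :: c :: r) t = geo (c :: r) t.
Proof.
case/andP=> c0 c1; apply/eqP; rewrite eq_le geo_critical_le ?c1 ?(ltW c0) //=.
rewrite -subr_ge0 -/(D c).
apply: (cvgr_to_ge (cvg_at_left_filter (@D_continuous c))).
near=> a; have ca : a < c by near: a; exact: nbhs_left_lt.
have a0 : 0 < a by near: a; exact: nbhs_left_gt.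
rewrite -(nmulr_rle0 _ (_ : a - c < 0)) ?subr_lt0 //; apply: D_sign.
by rewrite (ltW a0) (ltW (lt_trans ca c1)).
Unshelve. all: by end_near. Qed.

End Critical.

(** * The parameters of a maximizer *)

Section Maximizer.
Context (l : seq R) (t : nat).
Hypothesis l01 : all (fun a => 0 <= a <= 1) l.
Hypothesis lmax : forall l', unit_seq (size l) l' ->
  geo_norm l' * geo l' t <= geo_norm l * geo l t.
Hypothesis l_gt0 : 0 < geo_norm l * geo l t.

Lemma geo_norm_ge0 r : all (fun a => 0 <= a <= 1) r -> 0 <= geo_norm r.
Proof.
move=> /allP r01; rewrite /geo_norm big_seq; apply: prodr_ge0 => a /r01/andP[_].
by rewrite subr_ge0.
Qed.

Let l_ge0 : all (>= 0) l.
Proof. by apply: sub_all l01 => a /andP[]. Qed.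

Let geo_norm_gt0 : 0 < geo_norm l.
Proof.
rewrite lt_neqAle geo_norm_ge0 // andbT eq_sym.
by apply: contraTneq l_gt0 => ->; rewrite mul0r ltxx.
Qed.

Let geo_gt0 : 0 < geo l t.
Proof. by move: l_gt0; rewrite pmulr_rgt0. Qed.

Let l_lt1 a : a \in l -> 0 <= a < 1.
Proof.
move=> al; have /andP[a0 a1] := allP l01 a al.
rewrite a0 lt_neqAle a1 andbT; apply: contraTneq geo_norm_gt0 => a_1.
by rewrite /geo_norm (perm_big _ (perm_to_rem al)) /= big_cons a_1 subrr mul0r ltxx.
Qed.

Let l_rem_max c : c \in l -> forall a, 0 <= a <= 1 ->
  (1 - a) * geo (a :: rem c l) t <= (1 - c) * geo (c :: rem c l) t.
Proof.
move=> cl a a01; have lc := perm_to_rem cl.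
have normr0 : 0 < geo_norm (rem c l).
  have := geo_norm_gt0; rewrite /geo_norm (perm_big _ lc) /= big_cons pmulr_rgt0 //.
  by rewrite subr_gt0; have /andP[] := l_lt1 cl.
have := lmax (l' := a :: rem c l); rewrite (geo_perm_norm t lc).
rewrite /geo_norm !big_cons -/(geo_norm _) mulrAC [leRHS]mulrAC (ler_pM2r normr0).
apply; split; first by rewrite (perm_size lc).
by rewrite /= a01; apply/allP => b /mem_rem; exact: (allP l01).
Qed.

Let crit_le c : c \in l -> (1 - c) * geo (c :: l) t <= geo l t.
Proof.
move=> cl; have lc := perm_to_rem cl.
rewrite (geo_perm (_ : perm_eq (c :: l) (c :: c :: rem c l))) ?perm_cons //.
by rewrite (geo_perm lc) geo_critical_le ?l_lt1 //; exact: l_rem_max.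
Qed.

Let crit c : c \in l -> 0 < c -> (1 - c) * geo (c :: l) t = geo l t.
Proof.
move=> cl c0; have lc := perm_to_rem cl; have /andP[_ c1] := l_lt1 cl.
rewrite (geo_perm (_ : perm_eq (c :: l) (c :: c :: rem c l))) ?perm_cons //.
by rewrite (geo_perm lc) geo_critical ?c0 //; exact: l_rem_max.
Qed.

Let geo_cons_ge0 a r u : 0 <= a -> all (>= 0) r -> 0 <= geo (a :: r) u.
Proof. by move=> a0 r0; apply: geo_ge0; rewrite /= a0. Qed.

(* At two distinct parameters the criticality equations force a convolution with a
   geometric law to attain the maximum of the log-concave sequence it averages. *)
Let pos_eq c d : c \in l -> d \in l -> 0 < c -> 0 < d -> c = d.
Proof.
move=> cl dl c0 d0; apply/eqP/negPn/negP => cd.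
have Ec := crit cl c0; have Ed := crit dl d0.
have /andP[_ c1] := l_lt1 cl; have /andP[_ d1] := l_lt1 dl.
pose f := geo (d :: l).
have f0 u : 0 <= f u by apply: geo_cons_ge0 => //; exact: ltW.
have ftS : f t.+1 = f t.
  by rewrite /f geo_consS -Ed; ring.
have ft0 : 0 < f t by move: geo_gt0; rewrite -Ed pmulr_rgt0 // subr_gt0.
have lf : log_concave f by apply: geo_log_concave; rewrite /= (ltW d0).
have : (1 - c) * geom_conv c f t < f t.
  apply: geom_conv_lt; rewrite ?c0 // => i it; rewrite -ftS.
  by apply: log_concave_unimodal; rewrite ?ftS // ltnW // ltnW.
rewrite -[geom_conv c f]/(geo (c :: d :: l)).
have cd0 : c - d != 0 by rewrite subr_eq0.
have := geo_sub c d l t; rewrite -/f.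
(* Both criticality equations and [geo_sub] make the average of [f] equal to its maximum [f t],
   against the strict inequality. *)
set V := geo [:: c, d & l] t => E; suff -> : (1 - c) * V = f t by rewrite ltxx.
apply: (mulfI cd0); rewrite mulrCA -E mulrBr Ec -Ed -/f; ring.
Qed.

(** At [c = 0] the one-sided condition reads [geo l t.-1 <= geo l t], so [geo l] is largest at [t]
    among times up to [t]. A positive [d] would then average it strictly below that value, against
    criticality at [d]. *)
Let zero_eq c d : (0 < t)%N -> c \in l -> d \in l -> c = 0 -> d = 0.
Proof.
move=> t0 cl dl c0; apply/eqP/negPn/negP => dn0.
have /andP[d0 d1] := l_lt1 dl.
have {dn0}d0 : 0 < d by rewrite lt_neqAle eq_sym dn0.
have := crit_le cl; rewrite c0 subr0 mul1r -(prednK t0) geo_consS mul0r add0r => fle.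
have : (1 - d) * geom_conv d (geo l) t < geo l t.
  apply: geom_conv_lt; rewrite ?d0 // => i it.
  rewrite -(prednK t0); apply: log_concave_unimodal; rewrite ?prednK //.
  - exact: geo_log_concave.
  - by move=> u; exact: geo_ge0.
  - by rewrite prednK in fle.
  - exact: ltnW.
by rewrite -[geom_conv d _]/(geo (d :: l)) crit // ltxx.
Qed.

(** Once all parameters equal [c], criticality compares two consecutive binomial coefficients and
    becomes a linear equation for [c]. *)
Lemma maximizer_nseq : (0 < size l)%N -> (size l < t)%N ->
  l = nseq (size l) ((t - size l)%:R / t%:R).
Proof.
move=> l0 lt; have t0 : (0 < t)%N by exact: leq_ltn_trans lt.
pose c := head 0 l.
have cl : c \in l by rewrite /c; case: (l) l0 => //= a r _; rewrite mem_head.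
have /andP[c0 c1] := l_lt1 cl.
have lE : l = nseq (size l) c.
  apply/all_pred1P/allP => d dl /=; have /andP[d0 d1] := l_lt1 dl.
  have [cz|cz] := eqVneq c 0; first by rewrite cz (zero_eq t0 cl dl cz).
  have [dz|dz] := eqVneq d 0; first by rewrite dz (zero_eq t0 dl cl dz).
  by apply/eqP/pos_eq => //; rewrite lt_neqAle eq_sym ?cz ?dz.
move: l0 lt t0 lE geo_gt0 (@crit c cl).
case: (size l) => // k _; case: t => // u ku _ lE.
rewrite ltnS in ku.
rewrite lE -[c :: nseq _ _]/(nseq k.+2 c) !geo_nseq.
(* If [c = 0], the polynomial has positive degree and vanishes, against positivity of the
   maximum. *)
have [<-|cn0] := eqVneq 0 c.
  by rewrite expr0n subn_eq0 leqNgt ku /= mulr0 ltxx.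
move=> _ /(_ _)/wrap[]; first by rewrite lt_neqAle cn0.
rewrite -(subnSK ku) exprS !mulrA => /mulIf E.
have {E} E : (1 - c) * 'C(u, k.+1)%:R = 'C(u, k)%:R * c.
  by apply: E; rewrite expf_eq0 eq_sym (negPf cn0) andbF.
have := congr1 (fun m : nat => m%:R : R) (mul_bin_left u k).
rewrite !natrM => B.
have C0 : 'C(u, k)%:R != 0 :> R by rewrite pnatr_eq0 -lt0n bin_gt0 ltnW.
have {B} E2 : (1 - c) * (u - k)%:R = c * k.+1%:R.
  apply: (mulfI C0); rewrite mulrCA ['C(u, k)%:R * _ in LHS]mulrC -B mulrCA E; ring.
congr nseq; apply: (mulIf (_ : u.+1%:R != 0 :> R)); first by rewrite pnatr_eq0.
rewrite divfK ?pnatr_eq0 // subSS.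
have -> : u.+1%:R = (u - k)%:R + k.+1%:R :> R by rewrite -natrD; congr _%:R; lia.
lra.
Qed.

End Maximizer.

Lemma geo_norm_le l t : all (fun a => 0 <= a <= 1) l -> (size l < t)%N ->
  geo_norm l * geo l t <=
    2^-1 * Num.sqrt ((size l)%:R / (t%:R * (t%:R - (size l)%:R))).
Proof.
move=> l01 lt; set k := size l in lt *.
have [l' [l'k l'01] l'max] := geo_maximizer k t.
apply: le_trans (l'max l _) _ => //.
have [|l'0] := leP (geo_norm l' * geo l' t) 0.
  by move=> /le_trans; apply; rewrite mulr_ge0 ?sqrtr_ge0.
(* An empty sum is 0 almost surely, so it has no mass at [t > 0]. *)
have [k0|k0] := posnP k.
  move: l'0; rewrite k0 in l'k lt; case: l' l'k {l'01 l'max} => //= _.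
  by rewrite /geo /=; case: t lt => //= u _; rewrite mulr0 ltxx.
rewrite -l'k in l'max lt k0 *.
rewrite [in leLHS](maximizer_nseq l'01 l'max l'0) //.
have st : (size l' + (t - size l') = t)%N by rewrite subnKC // ltnW.
have := @binomial_mode_le R (size l') (t - size l') k0 _.
rewrite subn_gt0 st natrB ?(ltnW lt) // => /(_ lt); apply: le_trans.
case: (size l') k0 lt => // m _; case: (t) => // u mu.
rewrite geo_nseq /geo_norm big_nseq iter_mulr_1 subSS.
have -> : 1 - (u.+1%:R - m.+1%:R) / u.+1%:R = m.+1%:R / u.+1%:R :> R.
  by rewrite mulrBl divff ?pnatr_eq0 // opprB addrC subrK.
by rewrite mulrCA mulrA.
Qed.

End GeometricSums.

(** * Mixtures *)

Section GeometricMixtures.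
Context {R : realType}.
Implicit Types (th a : R) (l : seq R) (N t : nat) (f g : nat -> R).

(** Shifting [f] to [h] absorbs the factor z of [geom_conv]; the last term vanishes since
    [h 0 = 0]. *)
Lemma geom_conv_sum a f t (h : nat -> R) : h 0 = 0 -> (forall u, h u.+1 = f u) ->
  geom_conv a f t = \sum_(s < t.+1) a ^+ s * h (t - s)%N.
Proof.
move=> h0 hS; elim: t => [|t IH]; first by rewrite big_ord_recl big_ord0 h0 mulr0 addr0.
rewrite [LHS]/= IH [RHS]big_ord_recl expr0 mul1r subn0 hS addrC; congr (_ + _).
by rewrite mulr_sumr; apply: eq_bigr => s _; rewrite subSS exprS mulrA.
Qed.

(** The weights are not normalized: the sequence [geo l] has total mass [(geo_norm l)^-1] when its
    parameters are below 1. *)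
Definition geo_mixture th N f := exists s : seq (R * seq R),
  all (fun p => [&& 0 <= p.1, (size p.2 <= N)%N & all (fun a => 0 <= a <= th) p.2]) s /\
  forall t, f t = \sum_(p <- s) p.1 * geo p.2 t.

Lemma eq_geo_mixture th N f g : f =1 g -> geo_mixture th N f -> geo_mixture th N g.
Proof. by move=> fg [s [s_ok fE]]; exists s; split=> // t; rewrite -fg. Qed.

Lemma geo_mixture_geo th N l : (size l <= N)%N -> all (fun a => 0 <= a <= th) l ->
  geo_mixture th N (geo l).
Proof.
move=> lN lth; exists [:: (1, l)]; split; first by rewrite /= ler01 lN lth.
by move=> t; rewrite big_seq1 mul1r.
Qed.

Lemma geo_mixtureD th N f g : geo_mixture th N f -> geo_mixture th N g ->
  geo_mixture th N (fun t => f t + g t).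
Proof.
move=> [s [s_ok fE]] [s' [s'_ok gE]]; exists (s ++ s'); split.
  by rewrite all_cat s_ok.
by move=> t; rewrite big_cat fE gE.
Qed.

Lemma geo_mixtureZ th N c f : 0 <= c -> geo_mixture th N f ->
  geo_mixture th N (fun t => c * f t).
Proof.
move=> c0 [s [s_ok fE]]; exists [seq (c * p.1, p.2) | p <- s]; split.
  by rewrite all_map; apply: sub_all s_ok => p /= /and3P[p0 -> ->]; rewrite mulr_ge0.
by move=> t; rewrite big_map fE mulr_sumr; apply: eq_bigr => p _; rewrite mulrA.
Qed.

Lemma geo_mixture_sum th N (I : finType) (P : pred I) (f : I -> nat -> R) :
  (forall i, P i -> geo_mixture th N (f i)) ->
  geo_mixture th N (fun t => \sum_(i | P i) f i t).
Proof.
move=> fm; elim: (index_enum I) => [|i r IH].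
  by exists [::]; split=> // t; rewrite !big_nil.
have [Pi|Pi] := boolP (P i).
  apply: eq_geo_mixture (geo_mixtureD (fm i Pi) IH) => t.
  by rewrite big_cons Pi.
by apply: eq_geo_mixture IH => t; rewrite big_cons (negPf Pi).
Qed.

Lemma geo_mixture_conv th N a f : 0 <= a <= th -> geo_mixture th N f ->
  geo_mixture th N.+1 (geom_conv a f).
Proof.
move=> ath [s [s_ok fE]]; exists [seq (p.1, a :: p.2) | p <- s]; split.
  by rewrite all_map; apply: sub_all s_ok => p /= /and3P[-> pN ->]; rewrite ltnS pN ath.
elim=> [|t IH]; first by rewrite /= big_map big1 // => p _; rewrite mulr0.
rewrite /= IH fE !big_map mulr_sumr -big_split; apply: eq_bigr => p _ /=.
by rewrite mulrDr; congr (_ + _); rewrite mulrCA.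
Qed.

Lemma geo_norm_gt0 l : all (fun a => 0 <= a < 1) l -> 0 < geo_norm l.
Proof.
move=> /allP l1; rewrite /geo_norm big_seq prodr_gt0 // => a /l1/andP[_].
by rewrite subr_gt0.
Qed.

(** This is the generating function at z = 1. The partial sums are monotone and bounded, and the
    recurrence gives L = a L + 1 / [geo_norm l] for the limit. *)
Lemma series_geo_cvg l : all (fun a => 0 <= a < 1) l ->
  series (geo l) @ \oo --> (geo_norm l)^-1.
Proof.
elim: l => [_|a l IH].
  rewrite /geo_norm big_nil invr1.
  apply: cvg_near_cst; near=> n; rewrite /series /=.
  have n0 : (0 < n)%N by near: n; exact: nbhs_infty_gt.
  by rewrite big_ltn // big_nat_cond big1 ?addr0 // => -[|i] //=.
case/andP=> /andP[a0 a1] l01; have {}IH := IH l01.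
have alE n : series (geo (a :: l)) n.+1 =
    a * series (geo (a :: l)) n + series (geo l) n.
  rewrite /series [LHS]/= big_nat_recl // [X in X + _ = _]/= add0r mulr_sumr -big_split.
  by apply: eq_bigr.
have ge0 l' : all (fun a => 0 <= a < 1) l' -> forall u, 0 <= geo l' u.
  by move=> l'01 u; apply: geo_ge0; apply: sub_all l'01 => b /andP[].
have nd l' : all (fun a => 0 <= a < 1) l' -> nondecreasing_seq (series (geo l')).
  move=> l'01; apply/nondecreasing_seqP => n; rewrite /series /= big_nat_recr //=.
  by rewrite lerDl ge0.
have al01 : all (fun a => 0 <= a < 1) (a :: l) by rewrite /= a0 a1.
have a1' : 0 < 1 - a by rewrite subr_gt0.
have bound n : series (geo (a :: l)) n <= (1 - a)^-1 * (geo_norm l)^-1.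
  rewrite ler_pdivlMl // mulrBl mul1r lerBlDr.
  have := nd _ al01 _ _ (leqnSn n) => /le_trans; apply.
  rewrite alE addrC lerD2r -(cvg_lim _ IH) //.
  by apply: nondecreasing_cvgn_le; [exact: nd|exact: cvgP IH].
have cv : cvgn (series (geo (a :: l))).
  apply: nondecreasing_is_cvgn; first exact: nd.
  by exists ((1 - a)^-1 * (geo_norm l)^-1) => _ [n _ <-]; exact: bound.
suff <- : limn (series (geo (a :: l))) = (geo_norm (a :: l))^-1 by [].
set L := limn _.
have : [sequence series (geo (a :: l)) n.+1]_n @ \oo --> a * L + (geo_norm l)^-1.
  under eq_fun do rewrite alE.
  by apply: cvgD IH; apply: cvgMr; exact: cv.
rewrite cvg_shiftS => /cvg_lim -/(_ (@Rhausdorff R)); rewrite -/L => LE.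
have m0 : geo_norm l != 0 by rewrite gt_eqF // geo_norm_gt0.
rewrite /geo_norm big_cons -/(geo_norm l) invfM.
apply: (mulfI (lt0r_neq0 a1')).
by rewrite mulVKf ?gt_eqF //; lra.
Unshelve. all: by end_near. Qed.

Lemma ler_sqrt_ratio k N t : (k <= N)%N -> (N < t)%N ->
  Num.sqrt (k%:R / (t%:R * (t%:R - k%:R))) <=
  Num.sqrt (N%:R / (t%:R * (t%:R - N%:R))) :> R.
Proof.
move=> kN Nt; apply: ler_wsqrtr.
have kN' : k%:R <= N%:R :> R by rewrite ler_nat.
have Nt' : N%:R < t%:R :> R by rewrite ltr_nat.
have t0 : 0 < t%:R :> R by rewrite ltr0n; exact: leq_ltn_trans Nt.
have d0 : 0 < t%:R * (t%:R - N%:R) :> R by rewrite mulr_gt0 // subr_gt0.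
have d1 : t%:R * (t%:R - N%:R) <= t%:R * (t%:R - k%:R) :> R.
  by rewrite ler_pM2l // lerD2l lerN2.
have d2 := lt_le_trans d0 d1.
by apply: ler_pM => //; [rewrite invr_ge0 ltW|rewrite lef_pV2 ?posrE].
Qed.

(** Total mass at most 1 means that the weights [p.1 / geo_norm p.2] add up to at most 1, so the
    bound for a single sum of geometric variables passes to the mixture. *)
Lemma geo_mixture_le th N f t : 0 <= th < 1 -> geo_mixture th N f -> (N < t)%N ->
  (forall L, series f L <= 1) ->
  f t <= 2^-1 * Num.sqrt (N%:R / (t%:R * (t%:R - N%:R))).
Proof.
move=> /andP[th0 th1] [s [s_ok fE]] Nt f1; set B := _ * Num.sqrt _.
have B0 : 0 <= B by rewrite mulr_ge0 ?sqrtr_ge0.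
have s_ok1 p : p \in s -> [/\ 0 <= p.1, (size p.2 <= N)%N &
    all (fun a => 0 <= a < 1) p.2].
  move=> /(allP s_ok)/and3P[p0 pN pth]; split=> //.
  by apply: sub_all pth => a /andP[-> /le_lt_trans]; exact.
have tot : \sum_(p <- s) p.1 * (geo_norm p.2)^-1 <= 1.
  have : series f @ \oo --> \sum_(p <- s) p.1 * (geo_norm p.2)^-1.
    have -> : series f = (fun n => \sum_(p <- s) p.1 * series (geo p.2) n).
      apply/funext => n; rewrite /series /=.
      under eq_bigr do rewrite fE.
      by rewrite exchange_big; apply: eq_bigr => p _; rewrite mulr_sumr.
    rewrite big_seq; under eq_fun do rewrite big_seq.
    apply: cvg_big => [|p]; first exact: add_continuous.
    move=> /s_ok1[_ _ p1].
    by apply: cvgMr; exact: series_geo_cvg.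
  by move/cvgr_to_le; apply; near=> n; exact: f1.
rewrite fE; apply: (@le_trans _ _ (\sum_(p <- s) p.1 * (geo_norm p.2)^-1 * B)).
  rewrite big_seq [leRHS]big_seq; apply: ler_sum => p /s_ok1[p0 pN p1].
  rewrite -mulrA ler_wpM2l // ler_pdivlMl ?geo_norm_gt0 //.
  apply: le_trans (geo_norm_le _ _) _.
  - by apply: sub_all p1 => a /andP[-> /ltW].
  - exact: leq_ltn_trans Nt.
  by rewrite ler_wpM2l // ler_sqrt_ratio.
by rewrite -mulr_suml ler_piMl.
Unshelve. all: by end_near. Qed.

End GeometricMixtures.

(** * Last-visit decomposition of a reversible kernel *)

Section HittingKernel.
Context {R : realType} {S : finType}.
Implicit Types (q : S -> S -> R) (r g : S -> R) (D : {set S}) (a b c x : S) (t s : nat).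

(* The weight of the trajectories started at [a] that stay in [D] until time [t - 1]
   and exit by a step of weight [r] at time [t]. *)
Fixpoint exit_weight q r D a t : R :=
  if t is t'.+1 then
    (t' == 0)%:R * r a + \sum_(b in D) q a b * exit_weight q r D b t'
  else 0.

(** The weight of the [s]-step trajectories from [a] to [b] that are in [D] at times 1 to [s]; the
    start [a] may lie outside [D]. *)
Fixpoint green q D a b s : R :=
  if s is s'.+1 then \sum_(c in D) q a c * green q D c b s' else (a == b)%:R.

Lemma exit_weight_scale th q r D a t :
  exit_weight (fun b c => th * q b c) (fun b => th * r b) D a t =
    th ^+ t * exit_weight q r D a t.
Proof.
elim: t a => [|t IH] a /=; first by rewrite mulr0.
rewrite mulrDr; congr (_ + _).
  by case: t {IH} => [|t]; rewrite ?mul0r ?mulr0 // expr1 !mul1r.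
rewrite mulr_sumr; apply: eq_bigr => b _.
by rewrite IH exprS; ring.
Qed.

(** The index [s] is the time of the last visit to [x], after which the trajectory stays in
    [D :\ x]. The first term collects the trajectories that never visit [x]. *)
Lemma exit_weight_last_visit q r D x a t : x \in D ->
  exit_weight q r D a t = (a != x)%:R * exit_weight q r (D :\ x) a t +
    \sum_(s < t.+1) green q D a x s * exit_weight q r (D :\ x) x (t - s).
Proof.
move=> xD; elim: t a => [|t IH] a.
  by rewrite /= big_ord_recl big_ord0 !mulr0 !addr0.
rewrite big_ord_recl subn0 addrA.
(* Never visiting [x] and leaving it for good at time 0 are the cases [a != x] and [a = x] of one
   expression. *)
have -> : (a != x)%:R * exit_weight q r (D :\ x) a t.+1 +
    green q D a x 0 * exit_weight q r (D :\ x) x t.+1 = exit_weight q r (D :\ x) a t.+1.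
  by rewrite [green _ _ _ _ _]/=; case: eqP => [->|_] /=; rewrite ?mul0r ?mul1r ?add0r ?addr0.
rewrite /= -addrA; congr (_ + _).
have -> : \sum_(b in D) q a b * exit_weight q r D b t =
    \sum_(b in D) q a b * ((b != x)%:R * exit_weight q r (D :\ x) b t) +
    \sum_(b in D) q a b *
      (\sum_(s < t.+1) green q D b x s * exit_weight q r (D :\ x) x (t - s)).
  by rewrite -big_split; apply: eq_bigr => b _ /=; rewrite -mulrDr -IH.
congr (_ + _).
  rewrite (bigD1 x) //= eqxx mul0r mulr0 add0r; apply: congr_big => // b.
    by rewrite !inE andbC.
  by case/andP=> _ ->; rewrite mul1r.
under [LHS]eq_bigr do rewrite mulr_sumr.
rewrite exchange_big; apply: eq_bigr => s _ /=.
by rewrite mulr_suml subSS; apply: eq_bigr => b _; rewrite mulrA.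
Qed.

Lemma series_exit_weight_le1 q r D a n : (forall b c, 0 <= q b c) ->
  (forall b, 0 <= r b) -> (forall b, r b + \sum_(c in D) q b c <= 1) ->
  series (exit_weight q r D a) n <= 1.
Proof.
move=> q0 r0 rq1; rewrite /series /=; elim: n a => [|n IH] a; first by rewrite big_nil.
rewrite big_nat_recl //= add0r big_split /= exchange_big /=.
apply: le_trans (rq1 a); apply: lerD.
  case: n {IH} => [|n]; first by rewrite big_nil.
  by rewrite big_nat_recl //= mul1r big1 ?addr0 // => i _; rewrite mul0r.
by apply: ler_sum => b _; rewrite -mulr_sumr ler_piMr.
Qed.

(** * Spectral bounds for a symmetrizable kernel *)

Section Reversible.
Context (q : S -> S -> R) (g : S -> R) (th : R).
Hypothesis q_ge0 : forall a b, 0 <= q a b.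
Hypothesis q_le : forall a, \sum_b q a b <= th.
Hypothesis g_gt0 : forall a, 0 < g a.

(* The reversible kernel conjugated by [g], the square root of a reversing measure. *)
Definition symmetrized a b := g a * q a b / g b.

Hypothesis sym : forall a b, symmetrized a b = symmetrized b a.
Hypothesis psd : forall u : S -> R,
  0 <= \sum_a \sum_b u a * symmetrized a b * u b.

(** Schur's test with weight [g]: after conjugation is undone, the row sums of [q] control the
    form. *)
Lemma symmetrized_form_le (u : S -> R) :
  \sum_a \sum_b u a * symmetrized a b * u b <= th * \sum_a u a ^+ 2.
Proof.
have gn0 a : g a != 0 by rewrite gt_eqF.
(* AM-GM: 2 u_a u_b <= (g_b / g_a) u_a^2 + (g_a / g_b) u_b^2 *)
have H a b : u a * symmetrized a b * u b <=
    2^-1 * (q a b * u a ^+ 2) + 2^-1 * (q b a * u b ^+ 2).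
  have -> : q b a = (g a / g b) * symmetrized a b.
    by rewrite sym /symmetrized; field; rewrite !gn0.
  have -> : q a b = (g b / g a) * symmetrized a b.
    by rewrite /symmetrized; field; rewrite !gn0.
  rewrite -subr_ge0.
  set m := symmetrized a b.
  have -> : 2^-1 * (g b / g a * m * u a ^+ 2) + 2^-1 * (g a / g b * m * u b ^+ 2) -
      u a * m * u b = 2^-1 * (m / (g a * g b)) * (g b * u a - g a * u b) ^+ 2.
    by field; rewrite !gn0.
  have g0 c : 0 <= g c by exact: ltW.
  have m0 : 0 <= m by rewrite divr_ge0 ?mulr_ge0.
  by rewrite mulr_ge0 ?sqr_ge0 // mulr_ge0 ?invr_ge0 // divr_ge0 // mulr_ge0.
apply: (@le_trans _ _ (\sum_a \sum_b (2^-1 * (q a b * u a ^+ 2) +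
    2^-1 * (q b a * u b ^+ 2)))).
  by apply: ler_sum => a _; apply: ler_sum => b _.
under eq_bigr do rewrite big_split /=.
rewrite big_split /= [X in _ + X]exchange_big /= -mulr2n.
rewrite mulr_sumr -[leLHS]mulr_natl mulr_sumr; apply: ler_sum => a _.
rewrite -mulr_sumr mulrA mulfV ?pnatr_eq0 // mul1r -mulr_suml.
by rewrite ler_wpM2r ?sqr_ge0.
Qed.

(** Powers of the symmetrized kernel cut down to [D] give [green] up to conjugation, which cancels
    on the diagonal. *)
Lemma green_moments D x : x \in D -> exists (m : nat) (w d : 'I_m -> R),
  [/\ forall k, 0 <= w k, forall k, 0 <= d k <= th &
  forall s, green q D x x s = \sum_k w k * d k ^+ s].
Proof.
move=> xD; pose e : 'I_#|S| -> S := enum_val.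
have sumE (F : S -> R) : \sum_i F (e i) = \sum_a F a.
  by rewrite (reindex e) //; exact/onW_bij/enum_val_bij.
pose M a b := (a \in D)%:R * (b \in D)%:R * symmetrized a b.
pose A : 'M[R]_#|S| := \matrix_(i, j) M (e i) (e j).
have symA : A^T = A.
  by apply/matrixP => i j; rewrite !mxE /M sym [X in X * _]mulrC.
pose v : 'rV[R]_#|S| := delta_mx 0 (enum_rank x).
have [w [d [w0 dA mom]]] := symmetric_moments v symA.
exists #|S|, w, d; split=> // [k|s].
  have /eigenvalueP[z zA zn0] := dA k.
  pose y a := z 0 (enum_rank a).
  have ye i : y (e i) = z 0 i by rewrite /y enum_valK.
  have zz : (z *m z^T) 0 0 = \sum_a y a ^+ 2.
    rewrite -sumE mxE; apply: eq_bigr => i _.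
    by rewrite ye mxE expr2.
  have zz0 : 0 < \sum_a y a ^+ 2.
    have [i zi] : exists i, z 0 i != 0 by apply/rV0Pn.
    rewrite (bigD1 (e i)) //= ltr_pwDl ?sumr_ge0 // => [|a _]; last exact: sqr_ge0.
    by rewrite lt_neqAle sqr_ge0 eq_sym sqrf_eq0 ye zi.
  (* The form of the cut matrix at an eigenvector is the full form at the eigenvector set to 0
     outside [D]; this puts the eigenvalue in [[0, th]]. *)
  pose u a := (a \in D)%:R * y a.
  have form : d k * \sum_a y a ^+ 2 = \sum_a \sum_b u a * symmetrized a b * u b.
    rewrite -zz -[LHS]/(d k * (z *m z^T) 0 0).
    have -> : d k * (z *m z^T) 0 0 = (z *m A *m z^T) 0 0.
      by rewrite zA -scalemxAl [RHS]mxE.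
    rewrite mxE exchange_big -sumE; apply: eq_bigr => j _ /=.
    rewrite !mxE mulr_suml -sumE; apply: eq_bigr => i _.
    by rewrite /u !ye mxE /M; ring.
  have uy a : u a ^+ 2 <= y a ^+ 2.
    by rewrite /u exprMn; case: (a \in D); rewrite ?expr1n ?mul1r // expr0n mul0r sqr_ge0.
  rewrite -(pmulr_lge0 _ zz0) form psd /= -(ler_pM2r zz0) form.
  apply: le_trans (symmetrized_form_le u) _.
  have th0 : 0 <= th by apply: le_trans (q_le x); exact: sumr_ge0.
  by rewrite ler_wpM2l // ler_sum.
rewrite -mom.
(* After the first step the vector vanishes outside [D], whereas [green] started outside [D] need
   not; hence the indicator. *)
have iterE j : iter s (mulmx^~ A) v 0 j =
    ((s == 0) || (e j \in D))%:R * (g (e j) * green q D (e j) x s / g x).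
  elim: s j => [|s IH] j.
    rewrite mxE eqxx /= mul1r.
    have -> : (j == enum_rank x) = (e j == x).
      by rewrite -(inj_eq enum_rank_inj) enum_valK.
    by case: eqP => [->|_]; rewrite ?mulr1 ?divff ?gt_eqF ?mulr0 ?mul0r.
  rewrite iterS mxE [RHS]/=.
  transitivity (\sum_c (c \in D)%:R * (g c * green q D c x s / g x) * M c (e j)).
    rewrite -sumE; apply: eq_bigr => i _; rewrite IH mxE /M.
    by case: (e i \in D); rewrite ?orbT // !mul0r !mulr0.
  rewrite mulr_sumr mulr_suml mulr_sumr [RHS]big_mkcond; apply: eq_bigr => c _ /=.
  rewrite /M sym /symmetrized; case: (c \in D); last by rewrite !mul0r.
  by rewrite [true%:R]mulr1n; field; rewrite !gt_eqF.
rewrite mxE (bigD1 (enum_rank x)) //= big1 => [|i ix]; last first.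
  by rewrite !mxE eqxx /= (negPf ix) mulr0.
rewrite addr0 !mxE !eqxx mulr1 iterE /e enum_rankK xD orbT mul1r.
by rewrite mulrAC divff ?mul1r // gt_eqF.
Qed.

(** Induction on the number of states. The visits to [x] contribute one geometric parameter; after
    the last one the trajectory exits or steps into [D :\ x], which has one state fewer. *)
Lemma exit_weight_mixture r D x : (forall a, 0 <= r a) -> x \in D ->
  geo_mixture th #|D| (exit_weight q r D x).
Proof.
move=> r0; move: {2}#|D| (erefl #|D|) => N; elim: N D x => [|N IH] D x DN xD.
  by move: xD; rewrite (cards0_eq DN) inE.
have DxN : #|D :\ x| = N by move: (cardsD1 x D); rewrite xD DN => -[].
have [m [w [d [w0 d_ok greenE]]]] := green_moments xD.
(* The time shift matches the factor z built into [geom_conv]. *)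
pose h := exit_weight q r (D :\ x) x; pose f t := h t.+1.
have fm : geo_mixture th N f.
  apply: geo_mixtureD; last first.
    apply: geo_mixture_sum => b bD; apply: geo_mixtureZ => //.
    by rewrite -DxN; apply: IH.
  apply: eq_geo_mixture (geo_mixtureZ (r0 x) (geo_mixture_geo (l := [::]) _ _)) => // t.
  by rewrite mulrC.
have : geo_mixture th N.+1 (fun t => \sum_k w k * geom_conv (d k) f t).
  by apply: geo_mixture_sum => k _; apply: geo_mixtureZ => //; exact: geo_mixture_conv.
rewrite DN; apply: eq_geo_mixture => t.
rewrite (exit_weight_last_visit _ _ _ _ xD) eqxx mul0r add0r.
under [RHS]eq_bigr do rewrite greenE mulr_suml.
rewrite [RHS]exchange_big; apply: eq_bigr => k _ /=.
rewrite (@geom_conv_sum _ _ _ _ h) // mulr_sumr.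
by apply: eq_bigr => s _; rewrite mulrA.
Qed.

End Reversible.

End HittingKernel.

(** * Hitting times *)

Section ReversibleChain.
Context {R : realType} {S : finType}.
Implicit Types (p : S -> S -> R) (g : S -> R).

Lemma reversible_symmetrized p : reversible p -> exists2 g,
  forall a, 0 < g a & forall a b, symmetrized p g a b = symmetrized p g b a.
Proof.
move=> [pi [pi0 _ bal]]; exists (fun a => Num.sqrt (pi a)) => [a|a b].
  by rewrite sqrtr_gt0.
have s0 a' : Num.sqrt (pi a') != 0 by rewrite sqrtr_eq0 -ltNge.
apply/eqP; rewrite eqr_div //; apply/eqP.
have := bal a b; rewrite -{1}(sqr_sqrtr (ltW (pi0 a))) -{1}(sqr_sqrtr (ltW (pi0 b))).
by rewrite !expr2; lra.
Qed.

(** Multiplying a left eigenvector of the symmetrized matrix by [g] gives one of [p] with the same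
    eigenvalue, and the quadratic form is the first spectral moment. *)
Lemma eigenvalue_psd p g : (forall a, 0 < g a) ->
  (forall a b, symmetrized p g a b = symmetrized p g b a) ->
  (forall a, eigenvalue (transition_matrix p) a -> 0 <= a) ->
  forall u : S -> R, 0 <= \sum_a \sum_b u a * symmetrized p g a b * u b.
Proof.
move=> g0 sym eig u; pose e : 'I_#|S| -> S := enum_val.
have gn0 a : g a != 0 by rewrite gt_eqF.
have sumE (F : S -> R) : \sum_i F (e i) = \sum_a F a.
  by rewrite (reindex e) //; exact/onW_bij/enum_val_bij.
pose A : 'M[R]_#|S| := \matrix_(i, j) symmetrized p g (e i) (e j).
have symA : A^T = A by apply/matrixP => i j; rewrite !mxE.
pose v : 'rV[R]_#|S| := \row_i u (e i).
have [w [d [w0 dA mom]]] := symmetric_moments v symA.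
have -> : \sum_a \sum_b u a * symmetrized p g a b * u b = (v *m A *m v^T) 0 0.
  rewrite mxE exchange_big -sumE; apply: eq_bigr => j _ /=.
  rewrite !mxE mulr_suml -sumE; apply: eq_bigr => i _.
  by rewrite !mxE.
rewrite (mom 1); apply: sumr_ge0 => k _; rewrite mulr_ge0 //; apply: eig.
have /eigenvalueP[z zA zn0] := dA k.
apply/eigenvalueP; exists (\row_i (z 0 i * g (e i))).
  apply/rowP => j; rewrite !mxE.
  have /rowP/(_ j) := zA; rewrite !mxE => zAj.
  rewrite mulrA -zAj mulr_suml; apply: eq_bigr => i _.
  by rewrite !mxE /symmetrized -!mulrA mulVf // mulr1.
apply: contraNneq zn0 => /rowP z0; apply/eqP/rowP => i.
by have := z0 i; rewrite !mxE => /eqP; rewrite mulf_eq0 (negPf (gn0 _)) orbF => /eqP.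
Qed.

Lemma exit_weight_le p (r : S -> R) (D : {set S}) x t :
  stochastic p -> reversible p ->
  (forall a, eigenvalue (transition_matrix p) a -> 0 <= a) ->
  (forall a, 0 <= r a) -> (forall a, r a + \sum_(b in D) p a b <= 1) ->
  x \in D -> (#|D| < t)%N ->
  exit_weight p r D x t <=
    2^-1 * Num.sqrt (#|D|%:R / (t%:R * (t%:R - #|D|%:R))).
Proof.
move=> [p0 p1] /reversible_symmetrized[g g0 sym] eig r0 rp1 xD Dt.
have psd := eigenvalue_psd g0 sym eig.
set B := _ * Num.sqrt _.
(* Damping every step, the exit included, multiplies the weight at [t] by exactly [th ^+ t] and
   keeps all parameters below 1. *)
have le_th th : 0 < th < 1 -> th ^+ t * exit_weight p r D x t <= B.
  case/andP=> th0 th1; rewrite -exit_weight_scale.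
  pose q a b := th * p a b.
  have qE a b : symmetrized q g a b = th * symmetrized p g a b.
    by rewrite /symmetrized /q; ring.
  have r0' a : 0 <= th * r a by rewrite mulr_ge0 // ltW.
  apply: (geo_mixture_le (th := th)) => //; first by rewrite ltW.
    apply: (exit_weight_mixture (g := g)) => //.
    - by move=> a b; rewrite mulr_ge0 // ltW.
    - by move=> a; rewrite -mulr_sumr p1 mulr1.
    - by move=> a b; rewrite !qE sym.
    - move=> u; have -> : \sum_a \sum_b u a * symmetrized q g a b * u b =
          th * \sum_a \sum_b u a * symmetrized p g a b * u b.
        rewrite mulr_sumr; apply: eq_bigr => a _; rewrite mulr_sumr.
        by apply: eq_bigr => b _; rewrite qE; ring.
      by rewrite mulr_ge0 // ltW.
  move=> n; apply: series_exit_weight_le1 => // [a b|a].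
    by rewrite mulr_ge0 // ltW.
  rewrite -mulr_sumr -mulrDr; apply: le_trans (rp1 a); rewrite ler_piMl ?(ltW th1) //.
  by rewrite addr_ge0 ?sumr_ge0.
have cv : th ^+ t * exit_weight p r D x t @[th --> (1 : R)^'-] -->
    1 ^+ t * exit_weight p r D x t.
  by apply: cvgMl; apply: cvg_at_left_filter; exact: exprn_continuous.
rewrite expr1n mul1r in cv.
apply: (cvgr_to_le cv); near=> th; apply: le_th.
have -> : 0 < th by near: th; exact: nbhs_left_gt.
by near: th; exact: nbhs_left_lt.
Unshelve. all: by end_near. Qed.

End ReversibleChain.

(** * From trajectories of the chain to exit weights *)

Section MarkovChain.
Context {R : realType} {S : finType} {d : measure_display} {T : measurableType d}.
Context (P : probability T R) (p : S -> S -> R) (X : nat -> T -> S) (y : S).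
Hypothesis hX : markov_chain P p X.

(** The state at time [u] is left free, because the path up to [u] is prescribed separately. *)
Definition first_hit u v : set T :=
  [set w | X (u + v)%N w = y /\ forall i, (0 < i < v)%N -> X (u + i)%N w <> y].

Lemma measurable_eq_state t a : measurable [set w | X t w = a].
Proof. exact: hX.1. Qed.

Lemma measurable_path_event s t : measurable (path_event X s t).
Proof.
have -> : path_event X s t = \bigcap_(i in [set i | (i <= t)%N]) [set w | X i w = s i].
  by [].
by apply: bigcap_measurableType => i _; exact: measurable_eq_state.
Qed.

Lemma measurable_first_hit u v : measurable (first_hit u v).
Proof.
apply: measurableI; first exact: measurable_eq_state.
apply: (@bigcap_measurableType _ _ (fun i => ~` [set w | X (u + i)%N w = y])
  [set i | (0 < i < v)%N]) => i _.
by apply: measurableC; exact: measurable_eq_state.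
Qed.

Lemma measure_split_state t (A : set T) : measurable A ->
  P A = (\sum_(b : S) P (A `&` [set w | X t w = b]))%E.
Proof.
move=> mA.
have -> : P A = P (\bigcup_(b in [set: S]) (A `&` [set w | X t w = b])).
  congr (P _); apply/seteqP; split=> [w Aw|w [b _ []//]].
  by exists (X t w).
rewrite measure_fin_bigcup //.
- rewrite (fsbig_fwiden (index_enum S)) ?index_enum_uniq //= => b.
    by move=> _; exact: mem_index_enum.
  by move=> [_ /(_ I)].
- exact: finite_finset.
- by move=> b c _ _ [w [[_ <-] [_ <-]]].
- by move=> b _; apply: measurableI => //; exact: measurable_eq_state.
Qed.

(** Induction on [v]: split according to the state at time [u.+1] and extend the prescribed path by
    it. Prescribing the whole past lets the Markov property apply at each step. *)
Lemma path_event_first_hit s u v :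
  P (path_event X s u `&` first_hit u v.+1) =
  (P (path_event X s u) *
    (exit_weight p (p^~ y) [set~ y] (s u) v.+1)%:E)%E.
Proof.
elim: v s u => [|v IH] s u.
  rewrite /= mul1r big1 ?addr0 => [|b _]; last by rewrite mulr0.
  pose s' i := if i == u.+1 then y else s i.
  have s's i : (i <= u)%N -> s' i = s i by rewrite /s'; case: eqP => // ->; rewrite ltnn.
  have E : path_event X s' u = path_event X s u.
    by apply/seteqP; split=> w H i iu; rewrite H // s's.
  have := hX.2 s' u; rewrite E s's // {2}/s' eqxx => <-; congr (P _).
  apply/seteqP; split=> w.
    move=> [Hs [Hy _]] i; rewrite leq_eqVlt => /predU1P[->|iu].
      by rewrite /s' eqxx -Hy addn1.
    by rewrite s's // Hs.
  move=> H; split=> [i iu|]; first by rewrite -s's // H // leqW.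
  split; first by rewrite addn1 H // /s' eqxx.
  by case=> [|[|i]].
rewrite (measure_split_state u.+1); last first.
  by apply: measurableI; [exact: measurable_path_event|exact: measurable_first_hit].
rewrite [exit_weight _ _ _ _ _]/= mul0r add0r.
have /fineK Pfin : P (path_event X s u) \is a fin_num.
  by apply: fin_num_measure; exact: measurable_path_event.
rewrite -Pfin -EFinM mulr_sumr -sumEFin.
rewrite [RHS]big_mkcond /=; apply: eq_bigr => b _.
rewrite !inE; case: eqVneq => [->|by_] /=.
  (* Being at [y] at time [u.+1] would be too early a hit. *)
  rewrite (_ : _ `&` _ = set0) ?measure0 //.
  rewrite -subset0 => w [[_ [_ /(_ 1%N)]]].
  by rewrite addn1 => H1 H2; exact: H1.
pose s' i := if i == u.+1 then b else s i.
have s'u : s' u.+1 = b by rewrite /s' eqxx.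
have s's i : (i <= u)%N -> s' i = s i by rewrite /s'; case: eqP => // ->; rewrite ltnn.
have E : path_event X s' u = path_event X s u.
  by apply/seteqP; split=> w H i iu; rewrite H // s's.
rewrite EFinM Pfin EFinM muleA.
have := hX.2 s' u; rewrite E s's // s'u => <-.
have := IH s' u.+1; rewrite s'u => <-; congr (P _).
apply/seteqP; split=> w.
  move=> [[Hs [Hy Hn]] Hb]; split.
    move=> i; rewrite leq_eqVlt => /predU1P[->|iu]; first by rewrite s'u.
    by rewrite s's // Hs.
  split=> [|i iv]; first by rewrite addSnnS.
  by rewrite addSnnS; apply: Hn; move: iv; case: i.
move=> [Hs [Hy Hn]]; have Hb : X u.+1 w = b by rewrite Hs // s'u.
split=> //; split; first by move=> i iu; rewrite -s's // Hs // leqW.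
split=> [|[|[|i]] // iv]; first by rewrite -addSnnS.
  by rewrite addn1 Hb; apply/eqP.
by rewrite -addSnnS; apply: Hn.
Qed.

(** The hitting time counts a visit at time 0 and [first_hit 0 t] does not, hence the condition on
    the initial state. *)
Lemma hitting_time_event t : (0 < t)%N ->
  [set w | hitting_time X y w = Some t] =
    [set w | X 0%N w <> y] `&` first_hit 0 t.
Proof.
move=> t0; apply/seteqP; split=> w.
  rewrite /= /hitting_time; case: pselect => // hit [].
  case: ex_minnP => m /eqP Xm mmin mt; move: Xm mmin; rewrite mt => Xt tmin.
  split; first by move/eqP/tmin; rewrite leqNgt t0.
  split=> // i /andP[_ it] /eqP/tmin; by rewrite leqNgt it.
move=> [X0 [Xt Xi]]; rewrite /= /hitting_time; case: pselect; last first.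
  by case; exists t; apply/eqP.
move=> hit; congr Some; case: ex_minnP => m /eqP Xm mmin.
apply/eqP; rewrite eqn_leq mmin /=; last exact/eqP.
rewrite leqNgt; apply/negP => mt; case: (posnP m) => m0.
  by apply: X0; rewrite -Xm m0.
by apply: (Xi m) => //; rewrite m0.
Qed.

(** The factor [(x != y)%:R] is there because the exit weight started at [y] would count returns,
    while the hitting time is then 0. *)
Lemma hitting_time_le x t : P [set w | X 0%N w = x] = 1%E -> (0 < t)%N ->
  (P [set w | hitting_time X y w = Some t] <=
    ((x != y)%:R * exit_weight p (p^~ y) [set~ y] x t)%:E)%E.
Proof.
move=> hX0 t0; rewrite hitting_time_event //; set A := [set w | X 0%N w = x] in hX0.
have mA : measurable A by exact: measurable_eq_state.
have mE : measurable ([set w | X 0%N w <> y] `&` first_hit 0 t).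
  apply: measurableI; last exact: measurable_first_hit.
  by apply: measurableC; exact: measurable_eq_state.
have A0 : P (~` A) = 0%E by rewrite probability_setC // hX0 subee.
set E := _ `&` _ in mE *.
have EA : P E = P (E `&` A).
  apply/eqP; rewrite eq_le; apply/andP; split; last first.
    by apply: le_measure; rewrite ?inE //; exact: measurableI.
  rewrite -(measureU0 (measurableI _ _ mE mA) (measurableC mA) A0).
  apply: le_measure; rewrite ?inE //.
    by apply: measurableU; [exact: measurableI|exact: measurableC].
  by move=> w Ew; have [Aw|Aw] := pselect (A w); [left|right].
rewrite EA; have [xy|xy] := eqVneq x y.
  rewrite mul0r (_ : E `&` A = set0) ?measure0 //.
  by rewrite -subset0 => w [[X0 _]]; rewrite /A /= xy.
rewrite mul1r.
have Apath : path_event X (fun=> x) 0 = A.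
  by apply/seteqP; split=> w; [exact|move=> Aw i; rewrite leqn0 => /eqP ->].
have := path_event_first_hit (fun=> x) 0 t.-1.
rewrite Apath hX0 mul1e prednK // => <-.
apply: le_measure; rewrite ?inE.
- exact: measurableI.
- by apply: measurableI => //; exact: measurable_first_hit.
- by move=> w [[_ H] Aw].
Qed.

End MarkovChain.

Theorem mainTheorem4 (R : realType) (S : finType) (n : nat) (hn : #|S| = n)
    (p : S -> S -> R) (hp : stochastic p) (hrev : reversible p)
    (heig : forall a : R, eigenvalue (transition_matrix p) a -> 0 <= a)
    (x y : S)
    (d : measure_display) (T : measurableType d) (P : probability T R)
    (X : nat -> T -> S) (hX : markov_chain P p X)
    (hX0 : P [set w | X 0%N w = x] = 1%E)
    (t : nat) (ht : (n < t)%N) :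
  (P [set w | hitting_time X y w = Some t] <=
     (2^-1 * Num.sqrt (n%:R / (t%:R * (t%:R - n%:R))))%:E)%E.
Proof.
have t0 : (0 < t)%N by exact: leq_ltn_trans ht.
apply: le_trans (hitting_time_le y hX hX0 t0) _; rewrite lee_fin.
have [p0 p1] := hp.
have [_|xy] := eqVneq x y; first by rewrite mul0r mulr_ge0 ?sqrtr_ge0.
(* The killed chain lives on the complement of [y]; the bound grows with the number of states, so it
   may be stated with [n]. *)
have Dn : (#|[set~ y]%SET| <= n)%N by rewrite -hn max_card.
rewrite mul1r; apply: le_trans (exit_weight_le hp hrev heig _ _ _ _) _.
- by move=> a; exact: p0.
- move=> a; rewrite -[leRHS](p1 a) [leRHS](bigD1 y) //= lerD2l.
  by under eq_bigl do rewrite in_setC1.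
- by rewrite !inE.
- exact: leq_ltn_trans Dn ht.
by rewrite ler_wpM2l // ler_sqrt_ratio.
Qed.
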